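(* Let $\mathcal{R}$ be a commutative ring with unity, let $\mathcal{A}$ be an $\mathcal{R}$-algebra which is generated by its idempotents, and let $\mathcal{X}$ be a right $\mathcal{A}$-module. If $\psi:\mathcal{A}\to\mathcal{X}$ is a local left multiplier, then $\psi$ is a left multiplier. In particular, $\mathcal{A}$ is a SLIP algebra.
   Context: All algebras are associative $\mathcal{R}$-algebras with unity $1$ and all modules are unital; modules over an $\mathcal{R}$-algebra are $\mathcal{R}$-modules in the compatible way. An algebra is generated by its idempotents if it coincides with the $\mathcal{R}$-subalgebra generated by all its idempotents. For an algebra $\mathcal{A}$ and a right $\mathcal{A}$-module $\mathcal{X}$, an $\mathcal{R}$-linear map $\psi:\mathcal{A}\to\mathcal{X}$ is a left multiplier if $\psi(a)=\psi(1)a$ for all $a\in\mathcal{A}$; it is a local left multiplier if for each $a\in\mathcal{A}$ there exists $x_a\in\mathcal{X}$ with $\psi(a)=x_a a$. An $\mathcal{R}$-linear map $\psi:\mathcal{A}\to\mathcal{A}$ is LIP (left-ideal-preserving) if $\psi(\mathcal{J})\subseteq\mathcal{J}$ for every left ideal $\mathcal{J}$ of $\mathcal{A}$ (equivalently, $\psi$ is a local left multiplier from $\mathcal{A}$ to $\mathcal{A}$). The algebra $\mathcal{A}$ is SLIP if every LIP map on $\mathcal{A}$ is a left multiplier. *)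

(* Defs.v *)
From mathcomp Require Import all_boot all_algebra.
From mathcomp Require Import classical_sets.

Set Implicit Arguments.
Unset Strict Implicit.
Unset Printing Implicit Defensive.

Import GRing.Theory.
Local Open Scope ring_scope.
Local Open Scope classical_set_scope.

Section Definitions.
(* [algType R] carries 1 != 0, so only nonzero algebras are considered. *)
Variables (R : comPzRingType) (A : algType R).

Record is_subalgebra (S : set A) : Prop := IsSubalgebra {
  subalgebra1 : S 1;
  subalgebraD : forall a b, S a -> S b -> S (a + b);
  subalgebraZ : forall (r : R) a, S a -> S (r *: a);
  subalgebraM : forall a b, S a -> S b -> S (a * b)
}.

Definition generated_by_idempotents : Prop :=
  smallest is_subalgebra [set e : A | e * e = e] = [set: A].

(* MathComp modules are left modules, so a right A-module is an R-module X with
   an action [act x a] (written x a on paper) compatible with scalars. *)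
Record is_right_module (X : lmodType R) (act : X -> A -> X) : Prop :=
  IsRightModule {
  ractDl : forall x y a, act (x + y) a = act x a + act y a;
  ractDr : forall x a b, act x (a + b) = act x a + act x b;
  ractA : forall x a b, act x (a * b) = act (act x a) b;
  ract1 : forall x, act x 1 = x;
  ractZl : forall (r : R) x a, act (r *: x) a = r *: act x a;
  ractZr : forall (r : R) x a, act x (r *: a) = r *: act x a
}.

Lemma mul_is_right_module : is_right_module (@GRing.mul A).
Proof.
split=> *; rewrite ?mulrDl ?mulrDr ?mulrA ?mulr1 //.
- by rewrite scalerAl.
- by rewrite scalerAr.
Qed.

Definition left_multiplier (X : lmodType R) (act : X -> A -> X)
    (psi : {linear A -> X}) : Prop :=
  forall a, psi a = act (psi 1) a.

Definition local_left_multiplier (X : lmodType R) (act : X -> A -> X)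
    (psi : {linear A -> X}) : Prop :=
  forall a, exists x, psi a = act x a.

(* Stability under scalars is automatic: r *: u = (r *: 1) * u. *)
Record is_left_ideal (J : set A) : Prop := IsLeftIdeal {
  left_ideal0 : J 0;
  left_idealD : forall u v, J u -> J v -> J (u + v);
  left_idealM : forall a u, J u -> J (a * u)
}.

Definition LIP (psi : {linear A -> A}) : Prop :=
  forall J, is_left_ideal J -> psi @` J `<=` J.

Definition SLIP : Prop :=
  forall psi : {linear A -> A}, LIP psi -> left_multiplier (@GRing.mul A) psi.

End Definitions.

Arguments generated_by_idempotents {R} A.
Arguments SLIP {R} A.

(* Main.v *)
Require Import Defs.
From mathcomp Require Import all_boot all_algebra.
From mathcomp Require Import classical_sets.

Import GRing.Theory.
Local Open Scope ring_scope.

(** Let psi be a local left multiplier and e an idempotent.  Since psi (b e)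
    has the form x b e, right multiplication by e fixes it; since
    psi (b (1 - e)) has the form y b (1 - e), right multiplication by e kills
    it.  Splitting b = b e + b (1 - e) gives psi (b e) = psi b e for every b
    ([local_left_multiplier_idem]).

    The elements a satisfying psi (b a) = psi b a for _every_ b form a
    subalgebra ([right_compatible_subalgebra]).  It contains all idempotents,
    so it is the whole algebra when these generate, and b = 1 gives the
    multiplier identity.

    The SLIP property is the case X = A: evaluating a left-ideal-preserving
    map at a, inside the principal left ideal A a, shows that the map is a
    local left multiplier ([LIP_local_left_multiplier]). *)

Section RightModule.
Variables (R : comPzRingType) (A : algType R) (X : lmodType R).
Variables (act : X -> A -> X) (actP : is_right_module act).

Lemma ract0r (x : X) : act x 0 = 0.
Proof. by apply: (addIr (act x 0)); rewrite -(ractDr actP) !add0r. Qed.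

Variable psi : {linear A -> X}.

Lemma local_left_multiplier_idem (e b : A) :
  local_left_multiplier act psi -> e * e = e ->
  psi (b * e) = act (psi b) e.
Proof.
move=> psi_local idem_e.
have fixed_e : act (psi (b * e)) e = psi (b * e).
  by have [x ->] := psi_local (b * e); rewrite -(ractA actP) -mulrA idem_e.
have killed_e : act (psi (b * (1 - e))) e = 0.
  have [x ->] := psi_local (b * (1 - e)).
  by rewrite -(ractA actP) -mulrA mulrBl mul1r idem_e subrr mulr0 ract0r.
have split_b : b = b * e + b * (1 - e) by rewrite -mulrDr addrC subrK mulr1.
by rewrite [in RHS]split_b linearD (ractDl actP) fixed_e killed_e addr0.
Qed.

(** Quantifying over all b, rather than taking b = 1, is what makes the set
    closed under products: psi (b (a c)) is psi ((b a) c), so the condition on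
    c is needed at b a. *)
Lemma right_compatible_subalgebra :
  is_subalgebra [set a : A | forall b, psi (b * a) = act (psi b) a]%classic.
Proof.
split=> /=.
- by move=> b; rewrite mulr1 (ract1 actP).
- by move=> a c psi_a psi_c b; rewrite mulrDr linearD psi_a psi_c (ractDr actP).
- by move=> r a psi_a b; rewrite -scalerAr linearZ /= psi_a (ractZr actP).
- by move=> a c psi_a psi_c b; rewrite mulrA psi_c psi_a (ractA actP).
Qed.

Lemma local_left_multiplier_left_multiplier :
  generated_by_idempotents A ->
  local_left_multiplier act psi -> left_multiplier act psi.
Proof.
move=> genA psi_local a.
have : [set: A]%classic a by [].
rewrite -genA => /(_ _ (conj right_compatible_subalgebra _)) /= psi_a.
rewrite -psi_a ?mul1r // => e idem_e b.
exact: local_left_multiplier_idem.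
Qed.

End RightModule.

Lemma principal_left_ideal (R : comPzRingType) (A : algType R) (a : A) :
  is_left_ideal [set u : A | exists x, u = x * a]%classic.
Proof.
split=> /=.
- by exists 0; rewrite mul0r.
- by move=> _ _ [x ->] [y ->]; exists (x + y); rewrite mulrDl.
- by move=> b _ [x ->]; exists (b * x); rewrite mulrA.
Qed.

Lemma LIP_local_left_multiplier (R : comPzRingType) (A : algType R)
    (psi : {linear A -> A}) :
  LIP psi -> local_left_multiplier (@GRing.mul A) psi.
Proof.
move=> psi_LIP a; apply: (psi_LIP _ (principal_left_ideal _ _ a)).
by exists a => //=; exists 1; rewrite mul1r.
Qed.

Theorem theorem3p2 (R : comPzRingType) (A : algType R)
    (genA : generated_by_idempotents A) :
  (forall (X : lmodType R) (act : X -> A -> X) (psi : {linear A -> X}),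
     is_right_module act ->
     local_left_multiplier act psi ->
     left_multiplier act psi)
  /\ SLIP A.
Proof.
have local_mult (X : lmodType R) (act : X -> A -> X) (psi : {linear A -> X}) :
    is_right_module act ->
    local_left_multiplier act psi -> left_multiplier act psi.
  by move=> actP; apply: local_left_multiplier_left_multiplier.
split=> // psi psi_LIP; apply: local_mult; first exact: mul_is_right_module.
exact: LIP_local_left_multiplier.
Qed.
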